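(* Let $\phi\colon M\to S^3\times S^3$ be an almost complex surface in the nearly Kähler $S^3\times S^3$. Then $\Lambda\,dz^2=g(P\phi_z,\phi_z)\,dz^2$ is a holomorphic (quadratic) differential which is globally defined on $M$.
   Context: $S^3$ is the set of unit quaternions; tangent vectors at $(p,q)\in S^3\times S^3$ are written $Z=(U,V)$ with $U\in T_pS^3$, $V\in T_qS^3$. The nearly Kähler structure consists of $JZ=\frac{1}{\sqrt3}\bigl(2pq^{-1}V-U,\,-2qp^{-1}U+V\bigr)$ and $g(Z,Z')=\frac12\bigl(\langle Z,Z'\rangle+\langle JZ,JZ'\rangle\bigr)$, where $\langle\cdot,\cdot\rangle$ is the standard product metric. The almost product structure is $PZ=(pq^{-1}V,\,qp^{-1}U)$. An almost complex surface is an immersion $\phi\colon M\to S^3\times S^3$ of a 2-manifold with $J$-invariant tangent spaces. $M$ is a Riemann surface with local complex coordinates $z=u+iv$, where $(u,v)$ are isothermal coordinates for the metric induced by $g$ with $\phi_v=J\phi_u$. Put $\phi_z=\frac12(\phi_u-i\phi_v)$, with $g$ and $P$ extended complex (bi)linearly. *)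

(* Defs.v *)
From HB Require Import structures.
From mathcomp Require Import all_boot all_order all_algebra.
From mathcomp Require Import all_classical all_reals all_analysis.
From mathcomp Require Import complex.

Set Implicit Arguments.
Unset Strict Implicit.
Unset Printing Implicit Defensive.

Import Order.TTheory GRing.Theory Num.Theory.
Import numFieldNormedType.Exports.

Local Open Scope classical_set_scope.
Local Open Scope ring_scope.

Section Quaternions.
Context {R : realType}.

(* The row (a, b, c, d) stands for the quaternion a + b i + c j + d k. *)
Definition qmul (x y : 'rV[R]_4) : 'rV[R]_4 :=
  let x0 := x 0 0 in let x1 := x 0 1 in let x2 := x 0 2 in let x3 := x 0 3 in
  let y0 := y 0 0 in let y1 := y 0 1 in let y2 := y 0 2 in let y3 := y 0 3 in
  \row_k nth 0 [:: x0 * y0 - x1 * y1 - x2 * y2 - x3 * y3;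
                   x0 * y1 + x1 * y0 + x2 * y3 - x3 * y2;
                   x0 * y2 - x1 * y3 + x2 * y0 + x3 * y1;
                   x0 * y3 + x1 * y2 - x2 * y1 + x3 * y0] k.

Definition qdot (x y : 'rV[R]_4) : R := \sum_k x 0 k * y 0 k.

Definition qconj (x : 'rV[R]_4) : 'rV[R]_4 :=
  \row_k (if k == 0 then x 0 k else - x 0 k).

Definition qinv (x : 'rV[R]_4) : 'rV[R]_4 := (qdot x x)^-1 *: qconj x.

End Quaternions.

Notation ambient R := ('rV[R]_4 * 'rV[R]_4)%type.

Section NearlyKaehler.
Context {R : realType}.
Implicit Types (x Z W : ambient R).

(* S^3 x S^3 sits in the product of two copies of the quaternions, so that a
   tangent vector at x is a pair of quaternions; J, P and g are given by the
   formulas below at every x and are only meaningful for x in S^3 x S^3 and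
   tangent vectors Z, W at x. *)
Definition S3xS3 : set (ambient R) :=
  [set x | qdot x.1 x.1 = 1 /\ qdot x.2 x.2 = 1].

Definition nkJ x Z : ambient R :=
  let: (p, q) := x in let: (U, V) := Z in
  (Num.sqrt 3)^-1 *: (2 *: qmul (qmul p (qinv q)) V - U,
                      - (2 *: qmul (qmul q (qinv p)) U) + V).

Definition nkP x Z : ambient R :=
  let: (p, q) := x in let: (U, V) := Z in
  (qmul (qmul p (qinv q)) V, qmul (qmul q (qinv p)) U).

Definition prod_metric Z W : R := qdot Z.1 W.1 + qdot Z.2 W.2.

Definition nkg x Z W : R :=
  2^-1 * (prod_metric Z W + prod_metric (nkJ x Z) (nkJ x W)).

(* A complexified tangent vector A + i B is the pair (A, B). *)
Definition nkP_C x (Z : ambient R * ambient R) : ambient R * ambient R :=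
  (nkP x Z.1, nkP x Z.2).

Definition nkg_C x (Z W : ambient R * ambient R) : R[i] :=
  ((nkg x Z.1 W.1 - nkg x Z.2 W.2) +i* (nkg x Z.1 W.2 + nkg x Z.2 W.1))%C.

End NearlyKaehler.

Section Calculus.
Context {R : realType}.

Fixpoint Ck_on {V W : normedModType R} (n : nat) (U : set V) (f : V -> W) :
    Prop :=
  if n is m.+1 then
    (forall w, U w -> differentiable f w) /\ (forall v, Ck_on m U ('D_v f))
  else forall w, U w -> {for w, continuous f}.

Definition smooth_on {V W : normedModType R} (U : set V) (f : V -> W) : Prop :=
  forall n, Ck_on n U f.

Definition d_u {W : normedModType R} (f : R * R -> W) : R * R -> W :=
  'D_((1, 0) : R * R) f.
Definition d_v {W : normedModType R} (f : R * R -> W) : R * R -> W :=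
  'D_((0, 1) : R * R) f.

Definition zcoord (w : R * R) : R[i] := (w.1 +i* w.2)%C.

(* A complex function of (u, v), read as a function of z = u + i v; [^o] equips
   R[i] with its structure of normed space over itself, so that [derivable]
   and ['D_1] are complex differentiation. *)
Definition of_z (f : R * R -> R[i]) : R[i]^o -> R[i]^o :=
  fun z => f (complex.Re z, complex.Im z).

Definition holomorphic_on (U : set (R * R)) (f : R * R -> R[i]) : Prop :=
  forall w, U w -> derivable (of_z f) (zcoord w) 1.

Definition d_z (f : R * R -> R[i]) (w : R * R) : R[i] :=
  'D_1 (of_z f) (zcoord w).

End Calculus.

(* [coord] and [param] are total functions, but only their values on [dom] and
   [codom] matter. *)
Record chart (R : realType) (M : topologicalType) := Chart {
  dom : set M;
  codom : set (R * R);
  coord : M -> R * R;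
  param : R * R -> M;
  dom_open : open dom;
  codom_open : open codom;
  coord_codom : forall x, dom x -> codom (coord x);
  param_dom : forall w, codom w -> dom (param w);
  coordK : forall x, dom x -> param (coord x) = x;
  paramK : forall w, codom w -> coord (param w) = w;
  coord_continuous : forall x, dom x -> {for x, continuous coord};
  param_continuous : forall w, codom w -> {for w, continuous param}
}.

Section Transition.
Context {R : realType} {M : topologicalType}.
Implicit Types (c d : chart R M).

Definition overlap c d : set (R * R) :=
  codom c `&` [set w | dom d (param c w)].

Definition transition c d : R * R -> R * R := coord d \o param c.

Definition smooth_compatible c d : Prop :=
  smooth_on (overlap c d) (transition c d) /\
  smooth_on (overlap d c) (transition d c).

End Transition.

Record surface (R : realType) := Surface {
  carrier :> topologicalType;
  surface_hausdorff : hausdorff_space carrier;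
  surface_second_countable : @second_countable carrier;
  atlas : set (chart R carrier);
  atlas_cover : forall x : carrier, exists2 c, atlas c & dom c x;
  atlas_compatible :
    forall c d, atlas c -> atlas d -> smooth_compatible c d;
  atlas_maximal :
    forall c, (forall d, atlas d -> smooth_compatible c d) -> atlas c
}.

(* A Riemann surface structure on a smooth 2-manifold. *)
Record complex_structure (R : realType) (M : surface R) := ComplexStructure {
  complex_coordinate : set (chart R M);
  complex_smooth : complex_coordinate `<=` @atlas R M;
  complex_cover : forall x : M, exists2 c, complex_coordinate c & dom c x;
  complex_holomorphic :
    forall c d, complex_coordinate c -> complex_coordinate d ->
      holomorphic_on (overlap c d) (zcoord \o transition c d)
}.

Section AlmostComplexSurfaces.
Context {R : realType} {M : surface R}.
Implicit Types (phi : M -> ambient R) (c : chart R M) (w : R * R).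

Definition local phi c : R * R -> ambient R := phi \o param c.

Definition smooth_map phi : Prop :=
  forall c, atlas c -> smooth_on (codom c) (local phi c).

Definition immersion phi : Prop :=
  smooth_map phi /\
  forall c w, atlas c -> codom c w -> injective ('d (local phi c) w).

(* The range of the differential is the tangent space of the surface. *)
Definition J_invariant phi : Prop :=
  forall c w, atlas c -> codom c w ->
    forall Z, range ('d (local phi c) w) Z ->
      range ('d (local phi c) w) (nkJ (local phi c w) Z).

Definition almost_complex_surface phi : Prop :=
  [/\ forall x, S3xS3 (phi x), immersion phi & J_invariant phi].

Definition isothermal phi c : Prop :=
  forall w, codom c w ->
    let g := nkg (local phi c w) in
    let phi_u := d_u (local phi c) w in
    let phi_v := d_v (local phi c) w in
    g phi_u phi_u = g phi_v phi_v /\ g phi_u phi_v = 0.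

Definition J_oriented phi c : Prop :=
  forall w, codom c w ->
    d_v (local phi c) w = nkJ (local phi c w) (d_u (local phi c) w).

Definition phi_z phi c w : ambient R * ambient R :=
  (2^-1 *: d_u (local phi c) w, - (2^-1 *: d_v (local phi c) w)).

Definition Lambda phi c w : R[i] :=
  let x := local phi c w in nkg_C x (nkP_C x (phi_z phi c w)) (phi_z phi c w).

(* [L c] is the coefficient of dz^2 in the coordinate c; the second condition
   says that the local expressions L dz^2 agree on overlaps, i.e. define one
   quadratic differential on the whole of M. *)
Definition holomorphic_quadratic_differential (X : complex_structure M)
    (L : chart R M -> R * R -> R[i]) : Prop :=
  (forall c, complex_coordinate X c -> holomorphic_on (codom c) (L c)) /\
  (forall c d, complex_coordinate X c -> complex_coordinate X d ->
     forall w, overlap c d w ->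
     L c w = L d (transition c d w) * d_z (zcoord \o transition c d) w ^+ 2).

End AlmostComplexSurfaces.

(* Main.v *)
Require Import Defs.
From HB Require Import structures.
From mathcomp Require Import all_boot all_order all_algebra.
From mathcomp Require Import all_classical all_reals all_analysis.
From mathcomp Require Import complex.
From mathcomp Require Import ring lra.

(** The quadratic differential turns out to depend on the first factor only.
    In a J-oriented coordinate write (p, q) for the map and set
    alpha = p^-1 p_u, gamma = q^-1 q_u, which are imaginary quaternions.  In
    this left-invariant frame P swaps the two slots, J acts by
    (alpha, gamma) |-> (2 gamma - alpha, gamma - 2 alpha) / sqrt 3, and
    phi_v = J phi_u expresses p_v, q_v through alpha and gamma.  A computation
    with inner products ([nkg_C_phi_z]) then gives

      Lambda = (1 + i sqrt 3)/4 * ((|p_u|^2 - |p_v|^2) - 2 i <p_u, p_v>),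

    that is, Lambda is a constant times the complex bilinear square
    <p_z, p_z>.

    Holomorphy: the z-bar derivative of <p_z, p_z> is half the product of p_z
    with the Laplacian of p, so it is enough that p_uu + p_vv is orthogonal to
    p_u and p_v.  The first component of phi_v = J phi_u reads
    sqrt 3 p_v + p_u = 2 p q^-1 q_u, and that of J phi_v = - phi_u reads
    p_v - sqrt 3 p_u = 2 p q^-1 q_v.  Differentiating the former in v and the
    latter in u and subtracting, the mixed second derivatives cancel by
    Schwarz's theorem ([mixed_derivatives_eq]) and sqrt 3 (p_uu + p_vv) is a
    multiple of p (gamma^2 + alpha^2 - gamma alpha).  For imaginary alpha and
    gamma, the factor in parentheses is orthogonal to alpha and gamma
    ([imaginary_orthogonal]), hence the Laplacian to p_u and p_v
    ([J_holomorphic_laplacian]).  The real and imaginary parts therefore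
    satisfy the Cauchy-Riemann equations, which give complex
    differentiability ([is_derive_CauchyRiemann]).

    Global definition: a holomorphic transition map with derivative l
    multiplies phi_z by l, by the chain rule and the Cauchy-Riemann equations
    ([CauchyRiemann]), and g(P _, _) is complex bilinear
    ([nkg_C_scale]), so Lambda is multiplied by l^2. *)

Set Implicit Arguments.
Unset Strict Implicit.
Unset Printing Implicit Defensive.

Import Order.TTheory GRing.Theory Num.Theory.
Import numFieldNormedType.Exports.

Local Open Scope classical_set_scope.
Local Open Scope ring_scope.

(** * Quaternion algebra in coordinates *)

Section QuaternionAlgebra.
Context {R : realType}.
Implicit Types (x y z p : 'rV[R]_4) (a : R).

Lemma forall_ord4 (P : 'I_4 -> Prop) :
  P 0 -> P 1 -> P 2 -> P 3 -> forall k, P k.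
Proof.
move=> P0 P1 P2 P3 [[|[|[|[|//]]]] lt_k].
- by have -> : Ordinal lt_k = 0 by exact: val_inj.
- by have -> : Ordinal lt_k = 1 by exact: val_inj.
- by have -> : Ordinal lt_k = 2 by exact: val_inj.
- by have -> : Ordinal lt_k = 3 by exact: val_inj.
Qed.

Lemma row4P x y :
  x 0 0 = y 0 0 -> x 0 1 = y 0 1 -> x 0 2 = y 0 2 -> x 0 3 = y 0 3 -> x = y.
Proof. by move=> e0 e1 e2 e3; apply/rowP; exact: forall_ord4. Qed.

Lemma qdotE x y : qdot x y =
  x 0 0 * y 0 0 + x 0 1 * y 0 1 + x 0 2 * y 0 2 + x 0 3 * y 0 3.
Proof.
rewrite /qdot !big_ord_recr big_ord0 /= add0r.
by do 3?[congr (_ + _)]; congr (x 0 _ * y 0 _); exact: val_inj.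
Qed.

Lemma qdotC x y : qdot x y = qdot y x.
Proof. by rewrite !qdotE; ring. Qed.

Lemma qdotDl x y z : qdot (x + y) z = qdot x z + qdot y z.
Proof. by rewrite !qdotE !mxE; ring. Qed.

Lemma qdotZl a x y : qdot (a *: x) y = a * qdot x y.
Proof. by rewrite !qdotE !mxE; ring. Qed.

Lemma qdotNl x y : qdot (- x) y = - qdot x y.
Proof. by rewrite !qdotE !mxE; ring. Qed.

Lemma qdotZr a x y : qdot x (a *: y) = a * qdot x y.
Proof. by rewrite !qdotE !mxE; ring. Qed.

Lemma qmulA x y z : qmul x (qmul y z) = qmul (qmul x y) z.
Proof. by apply: row4P; rewrite !mxE /=; ring. Qed.

Lemma qmulDl x y z : qmul (x + y) z = qmul x z + qmul y z.
Proof. by apply: row4P; rewrite !mxE /=; ring. Qed.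

Lemma qmulDr z x y : qmul z (x + y) = qmul z x + qmul z y.
Proof. by apply: row4P; rewrite !mxE /=; ring. Qed.

Lemma qmulZl a x z : qmul (a *: x) z = a *: qmul x z.
Proof. by apply: row4P; rewrite !mxE /=; ring. Qed.

Lemma qmulZr a z x : qmul z (a *: x) = a *: qmul z x.
Proof. by apply: row4P; rewrite !mxE /=; ring. Qed.

Lemma qmulNl x z : qmul (- x) z = - qmul x z.
Proof. by apply: row4P; rewrite !mxE /=; ring. Qed.

Lemma qmulNr z x : qmul z (- x) = - qmul z x.
Proof. by apply: row4P; rewrite !mxE /=; ring. Qed.

Lemma qconjM x y : qconj (qmul x y) = qmul (qconj y) (qconj x).
Proof. by apply: row4P; rewrite !mxE /=; ring. Qed.

(** Left multiplication by a unit quaternion is invertible and isometric; these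
    facts let every computation be moved to the frame at the identity. *)
Lemma qmul_conjK x y : qmul (qconj x) (qmul x y) = qdot x x *: y.
Proof. by rewrite qdotE; apply: row4P; rewrite !mxE /=; ring. Qed.

Lemma qmulKconj x y : qmul x (qmul (qconj x) y) = qdot x x *: y.
Proof. by rewrite qdotE; apply: row4P; rewrite !mxE /=; ring. Qed.

Lemma qdot_mull p x y : qdot (qmul p x) (qmul p y) = qdot p p * qdot x y.
Proof. by rewrite !qdotE !mxE /=; ring. Qed.

(** A vector is tangent to the sphere at x exactly when its left translate to
    the identity is imaginary. *)
Lemma qconj_mul0 x y : qmul (qconj x) y 0 0 = qdot x y.
Proof. by rewrite qdotE !mxE /=; ring. Qed.

End QuaternionAlgebra.

(** * Directional derivatives of quaternion-valued maps *)

Lemma is_deriveP (R : numFieldType) (V W : normedModType R) (f : V -> W)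
    (w v : V) (df : W) :
  is_derive w v f df <->
  h^-1 *: (f (h *: v + w) - f w) @[h --> 0^'] --> df.
Proof.
split=> [[cf <-] //|cf].
by apply: DeriveDef; [exact: cvgP cf|exact: cvg_lim cf].
Qed.

Section DirectionalDerivatives.
Context {R : realType} {V : normedModType R}.

Lemma is_derive_ext (W : normedModType R) (f g : V -> W) w v df dg :
  is_derive w v f df -> f =1 g -> df = dg -> is_derive w v g dg.
Proof. by move=> dvf /funext <- <-. Qed.

Lemma is_derive_linear (W W' : normedModType R) (L : W -> W') (f : V -> W)
    (w v : V) (df : W) :
  linear L -> continuous L -> is_derive w v f df ->
  is_derive w v (L \o f) (L df).
Proof.
move=> linL cL /is_deriveP df_lim; apply/is_deriveP.
pose sL := GRing.isLinear.Build _ _ _ _ L linL.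
pose L' : {linear W -> W'} := HB.pack L sL.
have -> : (fun h => h^-1 *: ((L \o f) (h *: v + w) - (L \o f) w)) =
    L \o (fun h => h^-1 *: (f (h *: v + w) - f w)).
  by apply/funext => h /=; rewrite -[L]/(L' : _ -> _) linearZ_LR (linearB L').
apply: cvg_comp df_lim _; exact: cL.
Qed.

Lemma is_derive_fst (W W' : normedModType R) (f : V -> W * W') w v df :
  is_derive w v f df -> is_derive w v (fun w => (f w).1) df.1.
Proof.
by apply: (is_derive_linear (L := fst)) => [a x y //|x]; exact: cvg_fst.
Qed.

Lemma is_derive_snd (W W' : normedModType R) (f : V -> W * W') w v df :
  is_derive w v f df -> is_derive w v (fun w => (f w).2) df.2.
Proof.
by apply: (is_derive_linear (L := snd)) => [a x y //|x]; exact: cvg_snd.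
Qed.

Lemma is_derive_coord n (f : V -> 'rV[R]_n) w v df k :
  is_derive w v f df -> is_derive w v (fun w => f w 0 k) (df 0 k).
Proof.
apply: (is_derive_linear (L := fun x : 'rV[R]_n => x 0 k)) => [a x y|x].
  by rewrite !mxE.
exact: coord_continuous.
Qed.

Lemma is_derive_row n (f : V -> 'rV[R]_n) w v (df : 'rV[R]_n) :
  (forall k, is_derive w v (fun w => f w 0 k) (df 0 k)) -> is_derive w v f df.
Proof.
move=> dfk; have dvf : derivable f w v.
  by apply/derivable_mxP => i j; rewrite (ord1 i); exact: ex_derive.
apply: DeriveDef => //; rewrite derive_mx //; apply/rowP => k.
by rewrite mxE; exact: derive_val.
Qed.

Lemma is_derive_qmul (f g : V -> 'rV[R]_4) w v df dg :
  is_derive w v f df -> is_derive w v g dg ->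
  is_derive w v (fun w => qmul (f w) (g w)) (qmul df (g w) + qmul (f w) dg).
Proof.
move=> dvf dvg.
pose F k := fun w => f w 0 k; pose G k := fun w => g w 0 k.
have dF k : is_derive w v (F k) (df 0 k) by exact: is_derive_coord.
have dG k : is_derive w v (G k) (dg 0 k) by exact: is_derive_coord.
have scE (a b : R) : a *: b = a * b by [].
have dM i j := is_deriveM (dF i) (dG j).
(* The terms below spell out the four coordinates of the quaternion product. *)
apply: is_derive_row; apply: forall_ord4.
- apply: (is_derive_ext
    (is_deriveB (is_deriveB (is_deriveB (dM 0 0) (dM 1 1)) (dM 2 2)) (dM 3 3)))
    => [y|]; rewrite !mxE //= /F /G !scE; ring.
- apply: (is_derive_ext
    (is_deriveB (is_deriveD (is_deriveD (dM 0 1) (dM 1 0)) (dM 2 3)) (dM 3 2)))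
    => [y|]; rewrite !mxE //= /F /G !scE; ring.
- apply: (is_derive_ext
    (is_deriveD (is_deriveD (is_deriveB (dM 0 2) (dM 1 3)) (dM 2 0)) (dM 3 1)))
    => [y|]; rewrite !mxE //= /F /G !scE; ring.
- apply: (is_derive_ext
    (is_deriveD (is_deriveB (is_deriveD (dM 0 3) (dM 1 2)) (dM 2 1)) (dM 3 0)))
    => [y|]; rewrite !mxE //= /F /G !scE; ring.
Qed.

Lemma is_derive_qconj (f : V -> 'rV[R]_4) w v df :
  is_derive w v f df -> is_derive w v (fun w => qconj (f w)) (qconj df).
Proof.
move=> dvf; apply: is_derive_row => k.
have dfk := is_derive_coord k dvf.
rewrite (_ : (fun _ => _) =
    if k == 0 then (fun w => f w 0 k) else - (fun w => f w 0 k)).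
  by rewrite mxE; case: (k == 0); [exact: dfk|exact: is_deriveN].
by apply/funext => y; rewrite mxE; case: (k == 0).
Qed.

Lemma is_derive_qdot (f g : V -> 'rV[R]_4) w v df dg :
  is_derive w v f df -> is_derive w v g dg ->
  is_derive w v (fun w => qdot (f w) (g w)) (qdot df (g w) + qdot (f w) dg).
Proof.
move=> dvf dvg.
pose F k := fun w => f w 0 k; pose G k := fun w => g w 0 k.
have dF k : is_derive w v (F k) (df 0 k) by exact: is_derive_coord.
have dG k : is_derive w v (G k) (dg 0 k) by exact: is_derive_coord.
rewrite (_ : (fun _ => _) = \sum_k F k * G k).
  apply: is_derive_eq; rewrite -big_split; apply: eq_bigr => k _ /=.
  by rewrite addrC; congr (_ + _); exact: mulrC.
by apply/funext => y; rewrite fct_sumE.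
Qed.

Lemma differentiable_qdot (f g : V -> 'rV[R]_4) w :
  differentiable f w -> differentiable g w ->
  differentiable (fun w => qdot (f w) (g w)) w.
Proof.
move=> df dg.
rewrite (_ : (fun _ => _) = \sum_k (fun w => f w 0 k) * (fun w => g w 0 k)).
  apply: differentiable_sum => k; apply: differentiableM;
  exact: (differentiable_comp (g := fun x : 'rV[R]_4 => x 0 k) _
    (differentiable_coord _ _ _)).
by apply/funext => y; rewrite fct_sumE.
Qed.

End DirectionalDerivatives.

(** * Symmetry of mixed second derivatives *)

Section Schwarz.
Context {R : realType}.

Lemma is_derive_slice1 (f : R * R -> R) s t df :
  is_derive (s, t) ((1, 0) : R * R) f df ->
  is_derive s 1 (fun s => f (s, t)) df.
Proof.
move=> /is_deriveP dvf; apply/is_deriveP.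
rewrite [X in X @ _](_ : _ =
  fun h => h^-1 *: (f (h *: ((1, 0) : R * R) + (s, t)) - f (s, t))) //.
apply/funext => h; congr (_ *: (f _ - _)).
by rewrite -[RHS]/(h *: 1 + s, h *: 0 + t) scaler0 add0r.
Qed.

Lemma is_derive_slice2 (f : R * R -> R) s t df :
  is_derive (s, t) ((0, 1) : R * R) f df ->
  is_derive t 1 (fun t => f (s, t)) df.
Proof.
move=> /is_deriveP dvf; apply/is_deriveP.
rewrite [X in X @ _](_ : _ =
  fun h => h^-1 *: (f (h *: ((0, 1) : R * R) + (s, t)) - f (s, t))) //.
apply/funext => h; congr (_ *: (f _ - _)).
by rewrite -[RHS]/(h *: 0 + s, h *: 1 + t) scaler0 add0r.
Qed.

Lemma MVT_is_derive (f df : R -> R) (a h : R) : 0 < h ->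
  (forall s, s \in `[a, a + h]%R -> is_derive s 1 f (df s)) ->
  exists2 c, c \in `[a, a + h]%R & f (a + h) - f a = df c * h.
Proof.
move=> h_gt0 dvf.
have le_ah : a <= a + h by rewrite lerDl ltW.
have dvf_oo s : s \in `]a, a + h[%R -> is_derive s 1 f (df s).
  by move=> s_in; apply: dvf; exact: subset_itv_oo_cc.
have cf : {within `[a, a + h], continuous f}.
  apply: derivable_within_continuous => s s_in.
  by have dvfs := dvf s s_in; exact: ex_derive.
have [c c_in ->] := MVT_segment le_ah dvf_oo cf.
by exists c => //; rewrite addrAC subrr add0r.
Qed.

(** The mean value theorem is applied twice, first to the increment of f in the
    second variable, as a function of the first, then to f1. *)
Lemma second_difference (f f1 f12 : R -> R -> R) (x y h : R) : 0 < h ->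
  (forall s t, s \in `[x, x + h]%R -> t \in `[y, y + h]%R ->
     is_derive s 1 (f ^~ t) (f1 s t)) ->
  (forall s t, s \in `[x, x + h]%R -> t \in `[y, y + h]%R ->
     is_derive t 1 (f1 s) (f12 s t)) ->
  exists st, [/\ st.1 \in `[x, x + h]%R, st.2 \in `[y, y + h]%R &
    f (x + h) (y + h) - f (x + h) y - (f x (y + h) - f x y) =
    f12 st.1 st.2 * h * h].
Proof.
move=> h_gt0 dv1 dv12.
have y_in : y \in `[y, y + h]%R by rewrite in_itv /= lexx lerDl ltW.
have yh_in : y + h \in `[y, y + h]%R by rewrite in_itv /= lexx lerDl ltW.
have dv_diff s : s \in `[x, x + h]%R ->
    is_derive s 1 (fun s => f s (y + h) - f s y) (f1 s (y + h) - f1 s y).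
  by move=> s_in; exact: is_deriveB (dv1 s _ s_in yh_in) (dv1 s _ s_in y_in).
have [s s_in eq_s] := MVT_is_derive h_gt0 dv_diff.
have [t t_in eq_t] := MVT_is_derive h_gt0 (fun t => dv12 s t s_in).
by exists (s, t); split=> //=; rewrite -eq_t -eq_s.
Qed.

(** Schwarz's theorem.  The second difference of f over a small square is
    symmetric in the two variables, so it is h^2 times a value of fuv and also
    h^2 times a value of fvu, both taken near w; continuity concludes. *)
Lemma mixed_derivatives_eq (f fu fv fuv fvu : R * R -> R) (w : R * R) :
  (\forall z \near w, is_derive z ((1, 0) : R * R) f (fu z)) ->
  (\forall z \near w, is_derive z ((0, 1) : R * R) f (fv z)) ->
  (\forall z \near w, is_derive z ((0, 1) : R * R) fu (fuv z)) ->
  (\forall z \near w, is_derive z ((1, 0) : R * R) fv (fvu z)) ->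
  {for w, continuous fuv} -> {for w, continuous fvu} -> fuv w = fvu w.
Proof.
move=> du dv duv dvu cuv cvu; apply/eqP; rewrite -subr_eq0 -normr_le0.
apply/ler_addgt0Pl => e e_gt0; rewrite addr0.
have e2_gt0 : 0 < e / 2 by rewrite divr_gt0.
have /nbhs_ballP[/= d d_gt0 near_w] : \forall z \near w,
  [/\ is_derive z ((1, 0) : R * R) f (fu z),
      is_derive z ((0, 1) : R * R) f (fv z),
      is_derive z ((0, 1) : R * R) fu (fuv z),
      is_derive z ((1, 0) : R * R) fv (fvu z) &
      `|fuv w - fuv z| <= e / 2 /\ `|fvu w - fvu z| <= e / 2].
  near=> z; split; try by near: z.
  by split; near: z; [exact: (cvgrPdist_le _ _).1 cuv _ e2_gt0
                     |exact: (cvgrPdist_le _ _).1 cvu _ e2_gt0].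
(* Half the radius, so that the closed square lies in the open ball. *)
pose h := d / 2; have h_gt0 : 0 < h by rewrite divr_gt0.
have box s t : s \in `[w.1, w.1 + h]%R -> t \in `[w.2, w.2 + h]%R ->
    ball w d (s, t).
  rewrite !in_itv /= => /andP[s1 s2] /andP[t1 t2].
  have ltd r a : a <= r -> r <= a + h -> ball a d r.
    move=> ar ra; rewrite /ball /= ler0_norm ?subr_le0 // opprB ltrBlDl.
    by rewrite (le_lt_trans ra) // ltrD2l /h ltr_pdivrMr // ltr_pMr // ltr1n.
  by split; exact: ltd.
have [||[s t] [/= si ti eq_uv]] := second_difference
    (f := fun s t => f (s, t)) (f1 := fun s t => fu (s, t))
    (f12 := fun s t => fuv (s, t)) (x := w.1) (y := w.2) h_gt0.
- move=> s t si ti; apply: is_derive_slice1.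
  by have [] := near_w _ (box s t si ti).
- move=> s t si ti; apply: is_derive_slice2.
  by have [] := near_w _ (box s t si ti).
have [||[t' s'] [/= ti' si' eq_vu]] := second_difference
    (f := fun t s => f (s, t)) (f1 := fun t s => fv (s, t))
    (f12 := fun t s => fvu (s, t)) (x := w.2) (y := w.1) h_gt0.
- move=> t' s' ti' si'; apply: is_derive_slice2.
  by have [] := near_w _ (box s' t' si' ti').
- move=> t' s' ti' si'; apply: is_derive_slice1.
  by have [] := near_w _ (box s' t' si' ti').
have eq_mixed : fuv (s, t) = fvu (s', t').
  apply: (mulIf (lt0r_neq0 h_gt0)); apply: (mulIf (lt0r_neq0 h_gt0)).
  rewrite -eq_uv -eq_vu; ring.
have [_ _ _ _ [close_uv _]] := near_w _ (box _ _ si ti).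
have [_ _ _ _ [_ close_vu]] := near_w _ (box _ _ si' ti').
have -> : fuv w - fvu w =
    (fuv w - fuv (s, t)) - (fvu w - fvu (s', t')) by rewrite eq_mixed; ring.
by rewrite (le_trans (ler_normB _ _)) // [leRHS]splitr lerD.
Unshelve. all: by end_near. Qed.

End Schwarz.

(** * Complex differentiability and the Cauchy-Riemann equations *)

Section ComplexDerivative.
Context {R : realType}.
Implicit Types (a b : R * R -> R) (w : R * R).

Lemma normC_ge_Im (z : R[i]) : (`|complex.Im z|%:C)%C <= `|z|.
Proof.
by case: z => x y; simpc; rewrite /= -sqrtr_sqr ler_wsqrtr // lerDr sqr_ge0.
Qed.

Lemma normC_le_add (x y : R) : `|(x +i* y)%C| <= ((`|x| + `|y|)%:C)%C.
Proof.
simpc; rewrite /= -[leRHS]ger0_norm ?addr_ge0 // -sqrtr_sqr ler_wsqrtr //.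
rewrite sqrrD !real_normK ?num_real // addrAC lerDl.
by rewrite mulrn_wge0 // mulr_ge0.
Qed.

(** The topology of R[i] comes from its complex-valued modulus, that of R * R
    from the maximum norm; this transfers neighbourhoods from the latter to the
    former. *)
Lemma near_Re_Im w (P : set (R * R)) : (\forall k \near w, P k) ->
  \forall z \near (zcoord w : R[i]^o), P (complex.Re z, complex.Im z).
Proof.
move=> /nbhs_ballP[/= d d_gt0 dP]; apply/nbhs_ballP.
exists (d%:C)%C => /=; first by rewrite ltcR.
move=> z; rewrite -ball_normE /= => lt_zd; apply: dP.
rewrite -ball_normE /= prod_normE /= gt_max -!ltcR.
have := normc_ge_Re (zcoord w - z); have := normC_ge_Im (zcoord w - z).
rewrite !raddfB /= => Im_le Re_le.
by rewrite (le_lt_trans Re_le lt_zd) (le_lt_trans Im_le lt_zd).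
Qed.

Lemma diff_expansion a w e : differentiable a w -> 0 < e ->
  \forall k \near (0 : R * R),
    `|a (k + w) - a w - (k.1 * d_u a w + k.2 * d_v a w)| <= e * `|k|.
Proof.
move=> da e_gt0; have /diff_locallyP[_ /eqaddoP /(_ e e_gt0)] := da.
apply: filterS => k; rewrite /= !fctE /= opprD addrA.
suff -> : 'd a w k = k.1 * d_u a w + k.2 * d_v a w by [].
rewrite /d_u /d_v !deriveE //; case: k => s t /=.
rewrite -[s * _]/(s *: _) -[t * _]/(t *: _) -!linearZ -linearD.
congr ('d a w _).
rewrite -[RHS]/(s * 1 + t * 0, s * 0 + t * 1).
by rewrite !mulr0 !mulr1 addr0 add0r.
Qed.

(** Under the Cauchy-Riemann equations the real differential of a + i b is
    multiplication by a_u + i b_u, so the remainder of the complex difference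
    quotient is made of the two real first-order remainders. *)
Lemma is_derive_CauchyRiemann a b w :
  differentiable a w -> differentiable b w ->
  d_u a w = d_v b w -> d_v a w = - d_u b w ->
  is_derive (zcoord w : R[i]^o) 1 (of_z (fun w => (a w +i* b w)%C))
    (d_u a w +i* d_u b w)%C.
Proof.
move=> da db au_bv av_bu; apply/is_deriveP/cvgrPdist_le => /= e e_gt0.
have [e1 e1_gt0 e_e1] : exists2 e1 : R, 0 < e1 & e = ((e1 + e1)%:C)%C.
  exists (complex.Re e / 2).
    by rewrite divr_gt0 //; move: e_gt0; rewrite ltcE => /andP[].
  by rewrite -splitr; case: e e_gt0 => x y; rewrite ltcE => /andP[/eqP /= ->].
pose k (h : R[i]) := (complex.Re h, complex.Im h).
pose rem (c : R * R -> R) h :=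
  c (k h + w) - c w - ((k h).1 * d_u c w + (k h).2 * d_v c w).
have near_a : \forall h \near (0 : R[i]^o), `|rem a h| <= e1 * `|k h|.
  exact: (near_Re_Im (w := 0)) (diff_expansion da e1_gt0).
have near_b : \forall h \near (0 : R[i]^o), `|rem b h| <= e1 * `|k h|.
  exact: (near_Re_Im (w := 0)) (diff_expansion db e1_gt0).
have shiftE (h : R[i]) : h%:A + zcoord w = zcoord (k h + w).
  by rewrite [h%:A]mulr1; case: h => x y.
have remE (h : R[i]) : h * (d_u a w +i* d_u b w)%C -
    ((a (k h + w) +i* b (k h + w)) - (a w +i* b w))%C =
    - (rem a h +i* rem b h)%C.
  rewrite /rem av_bu -au_bv; case: h => x y; simpc.
  by congr (_ +i* _)%C => /=; ring.
near=> h.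
have h_neq0 : h != 0 by near: h; exact: (@nbhs_dnbhs_neq R[i]^o (0 : R[i])).
have ea : `|rem a h| <= e1 * `|k h|.
  by near: h; exact: (@nbhs_dnbhs R[i]^o _ _ near_a).
have eb : `|rem b h| <= e1 * `|k h|.
  by near: h; exact: (@nbhs_dnbhs R[i]^o _ _ near_b).
rewrite shiftE.
have -> : (d_u a w +i* d_u b w)%C - h^-1 *: (
    of_z (fun w => (a w +i* b w)%C) (zcoord (k h + w))
    - of_z (fun w => (a w +i* b w)%C) (zcoord w)) =
    - (h^-1 * (rem a h +i* rem b h)%C).
  apply: (mulfI h_neq0); rewrite -[_ *: _]/(_ * _) mulrBr mulrN !mulrA.
  rewrite divff // !mul1r -remE /of_z /zcoord /=.
  by rewrite -!surjective_pairing.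
rewrite normrN normrM normfV ler_pdivrMl ?normr_gt0 // e_e1.
apply: le_trans (normC_le_add _ _) _.
have h_ge : (`|k h|%:C)%C <= `|h|.
  rewrite prod_normE /=.
  by case: leP => _; [exact: normC_ge_Im|exact: normc_ge_Re].
apply: (@le_trans _ _ ((e1 + e1) * `|k h|)%:C%C).
  by rewrite lecR mulrDl lerD.
by rewrite rmorphM /= mulrC ler_wpM2r // lecR addr_ge0 // ltW.
Unshelve. all: by end_near. Qed.

Lemma cvg_Re_Im (T : Type) (F : set_system T) (FF : Filter F)
    (f : T -> R[i]^o) (l : R[i]^o) : f @ F --> l ->
  (complex.Re (f t) : R) @[t --> F] --> (complex.Re l : R) /\
  (complex.Im (f t) : R) @[t --> F] --> (complex.Im l : R).
Proof.
move=> /cvgrPdist_le fl; split; apply/cvgrPdist_le => e e_gt0;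
    have /fl : 0 < (e%:C)%C by rewrite ltcR.
- apply: filterS => t; rewrite -lecR; apply: le_trans.
  by rewrite -raddfB; exact: normc_ge_Re.
- apply: filterS => t; rewrite -lecR; apply: le_trans.
  by rewrite -raddfB; exact: normC_ge_Im.
Qed.

(** Taking c = 1 and c = i restricts a complex limit to the two coordinate
    axes. *)
Lemma cvg_real_line (c : R[i]) : c != 0 ->
  ((c * t%:C)%C : R[i]^o) @[t --> (0 : R)^'] --> (0 : R[i]^o)^'.
Proof.
move=> c_neq0 A /nbhs_ballP[/= e e_gt0 eA].
have ec_gt0 : 0 < e / `|c| by rewrite divr_gt0 ?normr_gt0.
have [d d_gt0 dE] : exists2 d : R, 0 < d & (d%:C)%C = e / `|c|.
  exists (complex.Re (e / `|c|)).
    by move: ec_gt0; rewrite ltcE => /andP[].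
  by case: (e / `|c|) ec_gt0 => x y; rewrite ltcE => /andP[/eqP /= ->].
apply/nbhs_ballP; exists d => //= t; rewrite -ball_normE /= sub0r normrN => td.
move=> t_neq0; apply: eA; last first.
  by rewrite mulf_neq0 // (inj_eq (@complexI R)).
rewrite -ball_normE /= sub0r normrN normrM mulrC -ltr_pdivlMr ?normr_gt0 //.
by rewrite -dE normc_def /= expr0n /= addr0 sqrtr_sqr ltcR.
Qed.

(** The complex difference quotient along the real axis has the difference
    quotients of a and b in u as its real and imaginary parts; along the
    imaginary axis it has those of b and - a in v. *)
Lemma CauchyRiemann a b w (l : R[i]^o) :
  is_derive (zcoord w : R[i]^o) 1 (of_z (fun w => (a w +i* b w)%C)) l ->
  [/\ is_derive w ((1, 0) : R * R) a (complex.Re l),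
      is_derive w ((1, 0) : R * R) b (complex.Im l),
      is_derive w ((0, 1) : R * R) a (- complex.Im l) &
      is_derive w ((0, 1) : R * R) b (complex.Re l)].
Proof.
move=> /is_deriveP cl.
have one_neq0 : (1 : R[i]) != 0 by rewrite oner_eq0.
have i_neq0 : ('i%C : R[i]) != 0 by rewrite eq_complex /= oner_eq0 andbF.
pose f := of_z (fun w => (a w +i* b w)%C).
pose q (h : R[i]) := h^-1 *: (f (h%:A + zcoord w) - f (zcoord w)).
pose qu (c : R * R -> R) (t : R) :=
  t^-1 *: (c (t *: ((1, 0) : R * R) + w) - c w).
pose qv (c : R * R -> R) (t : R) :=
  t^-1 *: (c (t *: ((0, 1) : R * R) + w) - c w).
have scale_pair (t x y : R) : t *: ((x, y) : R * R) = (t * x, t * y) by [].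
have pair_add (x y u v : R) : ((x, y) : R * R) + (u, v) = (x + u, y + v).
  by [].
have q_real t : q (1 * t%:C)%C = (qu a t +i* qu b t)%C.
  rewrite /q /f /of_z /qu scale_pair mul1r -fmorphV [_%:A]mulr1.
  rewrite -[_ *: _ in LHS]/(_ * _) mulr1 mulr0; case: (w) => u v.
  by rewrite pair_add -![_ *: _]/(_ * _) /=; simpc.
have q_imag t : q ('i * t%:C)%C = (qv b t +i* (- qv a t))%C.
  have i_inv : ('i%C)^-1 = - 'i%C :> R[i].
    by apply: (mulfI i_neq0); rewrite divff // mulrN -expr2 sqr_i opprK.
  rewrite /q /f /of_z /qv scale_pair invfM i_inv -fmorphV [_%:A]mulr1.
  rewrite -[_ *: _ in LHS]/(_ * _) mulr1 mulr0; case: (w) => u v.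
  by rewrite pair_add -![_ *: _]/(_ * _) /=; simpc.
have [re1 im1] := cvg_Re_Im _ (cvg_comp _ _ (cvg_real_line one_neq0) cl).
have [rei imi] := cvg_Re_Im _ (cvg_comp _ _ (cvg_real_line i_neq0) cl).
split; apply/is_deriveP.
- rewrite [X in X @ _](_ : _ = fun t => complex.Re (q (1 * t%:C)%C)) //.
  by apply/funext => t; rewrite q_real.
- rewrite [X in X @ _](_ : _ = fun t => complex.Im (q (1 * t%:C)%C)) //.
  by apply/funext => t; rewrite q_real.
- rewrite [X in X @ _](_ : _ = fun t => - complex.Im (q ('i * t%:C)%C)).
    exact: cvgN.
  by apply/funext => t; rewrite q_imag opprK.
- rewrite [X in X @ _](_ : _ = fun t => complex.Re (q ('i * t%:C)%C)) //.
  by apply/funext => t; rewrite q_imag.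
Qed.

End ComplexDerivative.

(** * The nearly Kaehler structure in the left-invariant frame *)

Section NearlyKaehlerAlgebra.
Context {R : realType}.
Implicit Types (p q al ga : 'rV[R]_4) (x Z W : ambient R).

Lemma qinv_unit p : qdot p p = 1 -> qinv p = qconj p.
Proof. by rewrite /qinv => ->; rewrite invr1 scale1r. Qed.

Lemma sqr_sqrt3 : Num.sqrt 3 ^+ 2 = 3 :> R.
Proof. by rewrite sqr_sqrtr. Qed.

Lemma invsqrt3 : (Num.sqrt 3)^-1 = Num.sqrt 3 / 3 :> R.
Proof.
have sqrt3_neq0 : Num.sqrt 3 != 0 :> R by rewrite sqrtr_eq0 -ltNge.
by apply: (mulfI sqrt3_neq0); rewrite divff // mulrA -expr2 sqr_sqrt3 divff.
Qed.

Lemma tangent_frame x Z : S3xS3 x ->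
  Z = (qmul x.1 (qmul (qconj x.1) Z.1), qmul x.2 (qmul (qconj x.2) Z.2)).
Proof.
by case: Z => U V [p1 q1]; rewrite !qmulKconj p1 q1 !scale1r.
Qed.

Lemma nkP_frame x al ga : S3xS3 x ->
  nkP x (qmul x.1 al, qmul x.2 ga) = (qmul x.1 ga, qmul x.2 al).
Proof.
case: x => p q [/= p1 q1]; rewrite /nkP !qinv_unit // -!qmulA !qmul_conjK.
by rewrite p1 q1 !scale1r.
Qed.

Lemma nkJ_frame x al ga : S3xS3 x ->
  nkJ x (qmul x.1 al, qmul x.2 ga) =
  (qmul x.1 ((Num.sqrt 3)^-1 *: (2 *: ga - al)),
   qmul x.2 ((Num.sqrt 3)^-1 *: (ga - 2 *: al))).
Proof.
case: x => p q [/= p1 q1]; rewrite /nkJ !qinv_unit // -!qmulA !qmul_conjK.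
rewrite p1 q1 !scale1r !qmulZr !qmulDr !qmulNr !qmulZr.
by rewrite [- _ + _]addrC.
Qed.

Lemma nkg_frame x al ga al' ga' : S3xS3 x ->
  nkg x (qmul x.1 al, qmul x.2 ga) (qmul x.1 al', qmul x.2 ga') =
  4 / 3 * (qdot al al' + qdot ga ga') - 2 / 3 * (qdot al ga' + qdot ga al').
Proof.
move=> Sx; rewrite /nkg !nkJ_frame // /prod_metric /= !qdot_mull.
case: Sx => -> ->; rewrite invsqrt3; have := sqr_sqrt3.
by move: (Num.sqrt 3) => r r2; rewrite !qdotE !mxE; field: r2.
Qed.

(** The pair is phi_z for phi_u = Z and phi_v = W.  In the frame both sides are
    quadratic forms in (al, ga), equal once sqrt 3 squared is replaced by 3.
    The constant is exp(i pi / 3) / 2. *)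
Lemma nkg_C_phi_z x Z W : S3xS3 x -> W = nkJ x Z ->
  nkg_C x (nkP_C x (2^-1 *: Z, - (2^-1 *: W))) (2^-1 *: Z, - (2^-1 *: W)) =
  (4^-1 +i* (Num.sqrt 3 / 4))%C *
  ((qdot Z.1 Z.1 - qdot W.1 W.1) +i* (- 2 * qdot Z.1 W.1))%C.
Proof.
move=> Sx ->; rewrite (tangent_frame Z Sx).
move: (qmul (qconj x.1) _) (qmul (qconj x.2) _) => al ga.
rewrite nkJ_frame //; set be := _ *: (_ - al); set de := _ *: (ga - _).
have half al' ga' : 2^-1 *: ((qmul x.1 al', qmul x.2 ga') : ambient R) =
    (qmul x.1 (2^-1 *: al'), qmul x.2 (2^-1 *: ga')) by rewrite !qmulZr.
have opp al' ga' : - ((qmul x.1 al', qmul x.2 ga') : ambient R) =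
    (qmul x.1 (- al'), qmul x.2 (- ga')) by rewrite !qmulNr.
rewrite !half opp /nkP_C /nkg_C !nkP_frame // !nkg_frame //= !qdot_mull.
case: (Sx) => -> _; rewrite /be /de !invsqrt3; simpc; have := sqr_sqrt3.
move: (Num.sqrt 3) => r r2.
by congr (_ +i* _)%C; rewrite !qdotE !mxE; field: r2.
Qed.

(** These are the first components of J Z = W and of J W = - Z, solved for the
    terms containing the second components of Z and W. *)
Lemma nkJ_relations x Z W : S3xS3 x -> W = nkJ x Z ->
  Num.sqrt 3 *: W.1 + Z.1 = 2 *: qmul (qmul x.1 (qconj x.2)) Z.2 /\
  W.1 - Num.sqrt 3 *: Z.1 = 2 *: qmul (qmul x.1 (qconj x.2)) W.2.
Proof.
move=> Sx ->; rewrite (tangent_frame Z Sx) nkJ_frame //=.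
move: (qmul (qconj x.1) _) (qmul (qconj x.2) _) => al ga.
rewrite -!qmulA !qmul_conjK; case: (Sx) => _ ->; rewrite !scale1r -!qmulZr.
rewrite -qmulNr -!qmulDr invsqrt3; have := sqr_sqrt3.
move: (Num.sqrt 3) => r r2.
by split; congr (qmul _ _); apply/rowP => k; rewrite !mxE; field: r2.
Qed.

(** The square of an imaginary quaternion is real, and <al, ga al> is |al|^2
    times the real part of ga; likewise for <ga, ga al>. *)
Lemma imaginary_orthogonal al ga : al 0 0 = 0 -> ga 0 0 = 0 ->
  let X := qmul ga ga + qmul al al - qmul ga al in
  qdot al X = 0 /\ qdot ga X = 0.
Proof. by move=> al0 ga0; rewrite /= !qdotE !mxE /= al0 ga0; split; ring. Qed.

(** The hypothesis on lap is what is left of the two relations [nkJ_relations]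
    after differentiation, once the mixed derivatives have cancelled.  In the
    frame the right-hand side becomes a multiple of
    x.1 (ga ga + al al - ga al). *)
Lemma laplacian_orthogonal x Z W (lap : 'rV[R]_4) :
  S3xS3 x -> qdot x.1 Z.1 = 0 -> qdot x.2 Z.2 = 0 -> W = nkJ x Z ->
  Num.sqrt 3 *: lap =
    2 *: (qmul (qmul W.1 (qconj x.2)) Z.2 - qmul (qmul Z.1 (qconj x.2)) W.2 +
          qmul (qmul x.1 (qconj W.2)) Z.2 - qmul (qmul x.1 (qconj Z.2)) W.2) ->
  qdot Z.1 lap = 0 /\ qdot W.1 lap = 0.
Proof.
move=> Sx tan1 tan2 -> lapE.
have sqrt3_neq0 : Num.sqrt 3 != 0 :> R by rewrite sqrtr_eq0 -ltNge.
suff [eZ eW] : qdot Z.1 (Num.sqrt 3 *: lap) = 0 /\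
    qdot (nkJ x Z).1 (Num.sqrt 3 *: lap) = 0.
  by split; apply: (mulfI sqrt3_neq0); rewrite -qdotZr mulr0.
rewrite {}lapE (tangent_frame Z Sx) nkJ_frame //=.
have al0 : qmul (qconj x.1) Z.1 0 0 = 0 by rewrite qconj_mul0.
have ga0 : qmul (qconj x.2) Z.2 0 0 = 0 by rewrite qconj_mul0.
move: (qmul (qconj x.1) _) (qmul (qconj x.2) _) al0 ga0 => al ga al0 ga0.
rewrite !qconjM -!qmulA !qmul_conjK; case: (Sx) => p1 ->; rewrite !scale1r.
rewrite -!qmulNr -!qmulDr -!qmulZr !qdot_mull p1 !mul1r.
set X := (X in 2 *: X).
have conj_im (y : 'rV[R]_4) : y 0 0 = 0 -> qconj y = - y.
  by move=> y0; apply: row4P; rewrite !mxE /= ?y0 ?oppr0.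
have de0 : ((Num.sqrt 3)^-1 *: (ga - 2 *: al)) 0 0 = 0.
  by rewrite !mxE al0 ga0; ring.
(* Conjugation is negation on imaginary quaternions, and the products al ga
   cancel. *)
have XE : X = (2 * (Num.sqrt 3)^-1) *: (qmul ga ga + qmul al al - qmul ga al).
  rewrite /X !conj_im // !qmulNl !qmulNr !qmulZl !qmulZr !qmulDl !qmulDr.
  rewrite !qmulNl !qmulNr !qmulZl !qmulZr.
  move: (qmul ga ga) (qmul al al) (qmul al ga) (qmul ga al) => gg aa ag ga'.
  by apply/rowP => k; rewrite !mxE; ring.
have [orth_al orth_ga] := imaginary_orthogonal al0 ga0.
rewrite XE !qdotZr orth_al qdotZl qdotDl qdotNl qdotZl orth_ga orth_al.
by split; ring.
Qed.

Lemma nkP_linear x : linear (nkP x).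
Proof.
by case: x => p q a [U1 V1] [U2 V2]; rewrite /= !qmulDr !qmulZr.
Qed.

Lemma nkJ_linear x : linear (nkJ x).
Proof.
case: x => p q a [U1 V1] [U2 V2]; rewrite /= !qmulDr !qmulZr.
move: (qmul _ V1) (qmul _ V2) (qmul _ U1) (qmul _ U2) => v1 v2 u1 u2.
by congr (_, _); apply/rowP => k; rewrite !mxE; ring.
Qed.

(** Complex bilinearity of g(P _, _): the scaled argument is
    (s + i t)(Z + i W). *)
Lemma nkg_C_scale x Z W (s t : R) :
  nkg_C x (nkP_C x (s *: Z - t *: W, t *: Z + s *: W))
    (s *: Z - t *: W, t *: Z + s *: W) =
  (s +i* t)%C ^+ 2 * nkg_C x (nkP_C x (Z, W)) (Z, W).
Proof.
have gC Z1 Z2 : nkg x Z1 Z2 = nkg x Z2 Z1.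
  rewrite /nkg /prod_metric; congr (_ * (_ + _ + (_ + _))); exact: qdotC.
have glin (a : R) Z1 Z2 Z3 :
    nkg x (a *: Z1 + Z2) Z3 = a * nkg x Z1 Z3 + nkg x Z2 Z3.
  rewrite /nkg nkJ_linear /prod_metric /= !qdotDl !qdotZl; ring.
have g0 Z3 : nkg x 0 Z3 = 0.
  by have := glin 1 0 0 Z3; rewrite scaler0 addr0; lra.
have gZ a Z1 Z2 : nkg x (a *: Z1) Z2 = a * nkg x Z1 Z2.
  by rewrite -[a *: Z1]addr0 glin g0 addr0.
have Q1 a Z1 b Z2 Z3 : nkg x (nkP x (a *: Z1 + b *: Z2)) Z3 =
    a * nkg x (nkP x Z1) Z3 + b * nkg x (nkP x Z2) Z3.
  have P0 : nkP x 0 = 0.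
    by have := nkP_linear x (-1) 0 0; rewrite scaler0 addr0 scaleN1r addNr.
  by rewrite nkP_linear glin -[b *: Z2]addr0 nkP_linear glin P0 g0 addr0.
have Q2 a Z1 b Z2 Z3 : nkg x Z3 (a *: Z1 + b *: Z2) =
    a * nkg x Z3 Z1 + b * nkg x Z3 Z2.
  by rewrite ![nkg x Z3 _]gC glin gZ.
rewrite /nkg_C /nkP_C /= -(scaleNr t W) !Q1 !Q2 expr2; simpc.
by congr (_ +i* _)%C; ring.
Qed.

End NearlyKaehlerAlgebra.

(** * Smooth maps *)

Section SmoothMaps.
Context {R : realType}.

Lemma smooth_on_differentiable (V W : normedModType R) (U : set V)
  (f : V -> W) w : smooth_on U f -> U w -> differentiable f w.
Proof. by move=> f_smooth Uw; have [df _] := f_smooth 1%N; exact: df. Qed.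

Lemma smooth_on_derive (V W : normedModType R) (U : set V) (f : V -> W) v :
  smooth_on U f -> smooth_on U ('D_v f).
Proof. by move=> f_smooth n; have [_] := f_smooth n.+1; exact. Qed.

Lemma smooth_on_is_derive (V W : normedModType R) (U : set V)
  (f : V -> W) w v : smooth_on U f -> U w -> is_derive w v f ('D_v f w).
Proof.
move=> f_smooth Uw; apply/derivableP/diff_derivable.
exact: smooth_on_differentiable f_smooth Uw.
Qed.

(** A linear functional reduces Schwarz's theorem for vector-valued maps to the
    real-valued case. *)
Lemma linear_mixed_derivatives_eq (W : normedModType R) (U : set (R * R))
    (f : R * R -> W) (C : W -> R) w :
  linear C -> continuous C -> open U -> smooth_on U f -> U w ->
  C (d_v (d_u f) w) = C (d_u (d_v f) w).
Proof.
move=> linC cC Uop f_smooth Uw; have nearU := open_nbhs_nbhs (conj Uop Uw).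
have u_smooth : smooth_on U (d_u f) by exact: smooth_on_derive.
have v_smooth : smooth_on U (d_v f) by exact: smooth_on_derive.
have cont g v : smooth_on U g -> {for w, continuous (C \o 'D_v g)}.
  move=> g_smooth; apply: continuous_comp (cC _).
  apply: differentiable_continuous; apply: smooth_on_differentiable Uw.
  exact: smooth_on_derive.
apply: (mixed_derivatives_eq (f := C \o f) (fu := C \o d_u f)
  (fv := C \o d_v f) (fuv := C \o d_v (d_u f)) (fvu := C \o d_u (d_v f)));
  try exact: cont; apply: filterS nearU => z Uz; apply: is_derive_linear => //;
  exact: smooth_on_is_derive Uz.
Qed.

Lemma ambient_mixed_derivatives_eq (U : set (R * R)) (f : R * R -> ambient R)
    w : open U -> smooth_on U f -> U w -> d_v (d_u f) w = d_u (d_v f) w.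
Proof.
move=> Uop f_smooth Uw.
suff [e1 e2] : (d_v (d_u f) w).1 = (d_u (d_v f) w).1 /\
    (d_v (d_u f) w).2 = (d_u (d_v f) w).2.
  by rewrite [LHS]surjective_pairing e1 e2 -surjective_pairing.
split; apply/rowP => k.
- apply: (linear_mixed_derivatives_eq (C := fun x : ambient R => x.1 0 k)
    _ _ Uop f_smooth Uw) => [a x y|x]; first by rewrite /= !mxE.
  apply: (@continuous_comp _ _ _ fst (fun y : 'rV[R]_4 => y 0 k)).
    exact: cvg_fst.
  exact: coord_continuous.
- apply: (linear_mixed_derivatives_eq (C := fun x : ambient R => x.2 0 k)
    _ _ Uop f_smooth Uw) => [a x y|x]; first by rewrite /= !mxE.
  apply: (@continuous_comp _ _ _ snd (fun y : 'rV[R]_4 => y 0 k)).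
    exact: cvg_snd.
  exact: coord_continuous.
Qed.

End SmoothMaps.

(** * Maps with phi_v = J phi_u *)

Section JHolomorphicMaps.
Context {R : realType}.
Implicit Types (U : set (R * R)) (L : R * R -> ambient R).

Lemma derive_eq_on_open (V W : normedModType R) (U : set V) (f g : V -> W)
    w v df dg :
  open U -> U w -> (forall z, U z -> f z = g z) ->
  is_derive w v f df -> is_derive w v g dg -> df = dg.
Proof.
move=> Uop Uw fg [_ <-] [_ <-]; apply: near_eq_derive.
exact: filterS fg (open_nbhs_nbhs (conj Uop Uw)).
Qed.

Lemma S3xS3_tangent U L w v : open U -> U w -> smooth_on U L ->
  (forall z, U z -> S3xS3 (L z)) ->
  qdot (L w).1 ('D_v L w).1 = 0 /\ qdot (L w).2 ('D_v L w).2 = 0.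
Proof.
move=> Uop Uw L_smooth SL.
have dL := smooth_on_is_derive v L_smooth Uw.
have orth (f : R * R -> 'rV[R]_4) df : is_derive w v f df ->
    (forall z, U z -> qdot (f z) (f z) = 1) -> qdot (f w) df = 0.
  move=> dvf f1.
  have := derive_eq_on_open Uop Uw f1 (is_derive_qdot dvf dvf)
    (is_derive_cst (1 : R) w v).
  by rewrite [qdot df _]qdotC; lra.
split; [apply: orth (is_derive_fst dL) _|apply: orth (is_derive_snd dL) _];
  by move=> z /SL[].
Qed.

(** The first components of J phi_u = phi_v and J phi_v = - phi_u are
    differentiated in v and in u respectively; their difference contains no
    mixed second derivative. *)
Lemma J_holomorphic_laplacian U L w : open U -> U w -> smooth_on U L ->
  (forall z, U z -> S3xS3 (L z)) ->
  (forall z, U z -> d_v L z = nkJ (L z) (d_u L z)) ->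
  let lap := (d_u (d_u L) w).1 + (d_v (d_v L) w).1 in
  qdot (d_u L w).1 lap = 0 /\ qdot (d_v L w).1 lap = 0.
Proof.
move=> Uop Uw L_smooth SL JL lap.
have u_smooth : smooth_on U (d_u L) by exact: smooth_on_derive.
have v_smooth : smooth_on U (d_v L) by exact: smooth_on_derive.
have E1 z : U z -> Num.sqrt 3 *: (d_v L z).1 + (d_u L z).1 =
    2 *: qmul (qmul (L z).1 (qconj (L z).2)) (d_u L z).2.
  by move=> Uz; exact: (nkJ_relations (SL z Uz) (JL z Uz)).1.
have E2 z : U z -> (d_v L z).1 - Num.sqrt 3 *: (d_u L z).1 =
    2 *: qmul (qmul (L z).1 (qconj (L z).2)) (d_v L z).2.
  by move=> Uz; exact: (nkJ_relations (SL z Uz) (JL z Uz)).2.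
have d1 (v : R * R) (f : R * R -> ambient R) (f_smooth : smooth_on U f) :=
  is_derive_fst (smooth_on_is_derive v f_smooth Uw).
have d2 (v : R * R) (f : R * R -> ambient R) (f_smooth : smooth_on U f) :=
  is_derive_snd (smooth_on_is_derive v f_smooth Uw).
have dprod (v : R * R) (f : R * R -> ambient R) (f_smooth : smooth_on U f) :=
  is_deriveZ 2 (is_derive_qmul (is_derive_qmul (d1 v _ L_smooth)
    (is_derive_qconj (d2 v _ L_smooth))) (d2 v f f_smooth)).
have dE1 := derive_eq_on_open Uop Uw E1
  (is_deriveD (is_deriveZ (Num.sqrt 3) (d1 (0, 1) _ v_smooth))
    (d1 (0, 1) _ u_smooth)) (dprod (0, 1) _ u_smooth).
have dE2 := derive_eq_on_open Uop Uw E2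
  (is_deriveB (d1 (1, 0) _ v_smooth)
    (is_deriveZ (Num.sqrt 3) (d1 (1, 0) _ u_smooth)))
  (dprod (1, 0) _ v_smooth).
have [tan1 tan2] := S3xS3_tangent (1, 0) Uop Uw L_smooth SL.
apply: (laplacian_orthogonal (SL w Uw) tan1 tan2 (JL w Uw)).
have mixed := ambient_mixed_derivatives_eq Uop L_smooth Uw.
have regroup (r : R) (a b c c' : 'rV[R]_4) : c = c' ->
    r *: (a + b) = (r *: b + c) - (c' - r *: a).
  by move=> ->; apply/rowP => k; rewrite !mxE; ring.
have cancel_mixed (m A B C D X Y e e' : 'rV[R]_4) : e = e' ->
    2 *: (qmul (A + B) X + qmul m e) - 2 *: (qmul (C + D) Y + qmul m e') =
    2 *: (qmul A X - qmul C Y + qmul B X - qmul D Y).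
  move=> ->; rewrite !qmulDl.
  move: (qmul A X) (qmul B X) (qmul C Y) (qmul D Y) (qmul m e') => a b c d f.
  by apply/rowP => k; rewrite !mxE; ring.
apply: (etrans (regroup _ _ _ _ _ (congr1 fst mixed))).
apply: (etrans (congr2 (fun a b => a - b) dE1 dE2)).
exact: cancel_mixed (congr1 snd mixed).
Qed.

(** For a and b the real and imaginary parts of |p_u|^2 - |p_v|^2 -
    2 i <p_u, p_v>, the difference a_u - b_v is 2 <p_u, p_uu + p_vv> and
    a_v + b_u is - 2 <p_v, p_uu + p_vv>. *)
Lemma CauchyRiemann_u (pu pv puu pvv puv pvu : 'rV[R]_4) :
  puv = pvu -> qdot pu (puu + pvv) = 0 ->
  qdot puu pu + qdot pu puu - (qdot pvu pv + qdot pv pvu) =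
  - 2 * (qdot puv pv + qdot pu pvv).
Proof.
move=> ->; rewrite [qdot pu (_ + _)]qdotC qdotDl [qdot pu puu]qdotC.
by rewrite [qdot pu pvv]qdotC [qdot pv pvu]qdotC; lra.
Qed.

Lemma CauchyRiemann_v (pu pv puu pvv puv pvu : 'rV[R]_4) :
  puv = pvu -> qdot pv (puu + pvv) = 0 ->
  qdot puv pu + qdot pu puv - (qdot pvv pv + qdot pv pvv) =
  - (- 2 * (qdot puu pv + qdot pu pvu)).
Proof.
move=> ->; rewrite [qdot pv (_ + _)]qdotC qdotDl.
by rewrite [qdot pu pvu]qdotC [qdot pv pvv]qdotC; lra.
Qed.

(** Up to a factor 4, the function is <p_z, p_z> for p the first component of
    L. *)
Lemma derivable_sqr_pz U L w : open U -> U w -> smooth_on U L ->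
  (forall z, U z -> S3xS3 (L z)) ->
  (forall z, U z -> d_v L z = nkJ (L z) (d_u L z)) ->
  derivable (of_z (fun z =>
      ((qdot (d_u L z).1 (d_u L z).1 - qdot (d_v L z).1 (d_v L z).1) +i*
       (- 2 * qdot (d_u L z).1 (d_v L z).1))%C))
    (zcoord w) 1.
Proof.
move=> Uop Uw L_smooth SL JL.
have [lap_u lap_v] := J_holomorphic_laplacian Uop Uw L_smooth SL JL.
have u_smooth : smooth_on U (d_u L) by exact: smooth_on_derive.
have v_smooth : smooth_on U (d_v L) by exact: smooth_on_derive.
have d1 (v : R * R) (f : R * R -> ambient R) (f_smooth : smooth_on U f) :=
  is_derive_fst (smooth_on_is_derive v f_smooth Uw).
have diff1 (f : R * R -> ambient R) :
    smooth_on U f -> differentiable (fun z => (f z).1) w.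
  move=> f_smooth; apply: (differentiable_comp (g := fst)).
    exact: smooth_on_differentiable Uw.
  by apply: linear_differentiable => x; exact: cvg_fst.
have da v := is_deriveB (is_derive_qdot (d1 v _ u_smooth) (d1 v _ u_smooth))
  (is_derive_qdot (d1 v _ v_smooth) (d1 v _ v_smooth)).
have db v :=
  is_deriveZ (- 2) (is_derive_qdot (d1 v _ u_smooth) (d1 v _ v_smooth)).
pose a z := qdot (d_u L z).1 (d_u L z).1 - qdot (d_v L z).1 (d_v L z).1.
pose b z := - 2 * qdot (d_u L z).1 (d_v L z).1.
have diff_a : differentiable a w.
  by apply: differentiableB; apply: differentiable_qdot; exact: diff1.
have diff_b : differentiable b w.
  by apply: differentiableZ; apply: differentiable_qdot; exact: diff1.
have mixed := congr1 fst (ambient_mixed_derivatives_eq Uop L_smooth Uw).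
have eq_u : d_u a w = d_v b w.
  apply: etrans (@derive_val _ _ _ _ _ _ _ (da (1, 0))) _.
  apply: etrans _ (esym (@derive_val _ _ _ _ _ _ _ (db (0, 1)))).
  exact: CauchyRiemann_u mixed lap_u.
have eq_v : d_v a w = - d_u b w.
  apply: etrans (@derive_val _ _ _ _ _ _ _ (da (0, 1))) _.
  apply: etrans _ (congr1 -%R (esym (@derive_val _ _ _ _ _ _ _ (db (1, 0))))).
  exact: CauchyRiemann_v mixed lap_v.
have cr := is_derive_CauchyRiemann diff_a diff_b eq_u eq_v.
by case: cr.
Qed.

End JHolomorphicMaps.

(** * The quadratic differential *)

Section QuadraticDifferential.
Context {R : realType} {M : surface R}.
Implicit Types (phi : M -> ambient R) (c d : chart R M) (w : R * R).

Lemma derive_comp_uv (W : normedModType R) (L : R * R -> W)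
    (T : R * R -> R * R) w v :
  differentiable T w -> differentiable L (T w) ->
  'D_v (L \o T) w =
  ('D_v T w).1 *: d_u L (T w) + ('D_v T w).2 *: d_v L (T w).
Proof.
move=> dT dL; rewrite [LHS]deriveE; last exact: differentiable_comp.
rewrite diff_comp // [in LHS]/= -[('d T w) v]deriveE //.
case: ('D_v T w) => s t; rewrite /d_u /d_v !deriveE // -!linearZ -linearD.
congr ('d L _ _).
by rewrite -[RHS]/(s * 1 + t * 0, s * 0 + t * 1) !mulr0 !mulr1 addr0 add0r.
Qed.

Lemma overlap_nbhs c d w : overlap c d w -> \forall z \near w, overlap c d z.
Proof.
move=> [cw dw]; have near_c := open_nbhs_nbhs (conj (@codom_open _ _ c) cw).
have near_d : \forall z \near w, dom d (param c z).
  exact: (param_continuous cw) (open_nbhs_nbhs (conj (@dom_open _ _ d) dw)).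
exact: filterI near_c near_d.
Qed.

Lemma local_transition phi c d w : overlap c d w ->
  local phi c w = (local phi d \o transition c d) w.
Proof.
by move=> [cw dw]; rewrite /local /transition /= coordK.
Qed.

Lemma LambdaE phi c w : S3xS3 (local phi c w) ->
  d_v (local phi c) w = nkJ (local phi c w) (d_u (local phi c) w) ->
  Lambda phi c w = (4^-1 +i* (Num.sqrt 3 / 4))%C *
    ((qdot (d_u (local phi c) w).1 (d_u (local phi c) w).1 -
      qdot (d_v (local phi c) w).1 (d_v (local phi c) w).1) +i*
     (- 2 * qdot (d_u (local phi c) w).1 (d_v (local phi c) w).1))%C.
Proof. by move=> Sw Jw; exact: nkg_C_phi_z Sw Jw. Qed.

Lemma Lambda_holomorphic phi c : (forall x, S3xS3 (phi x)) ->
  smooth_on (Defs.codom c) (local phi c) -> J_oriented phi c ->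
  holomorphic_on (Defs.codom c) (Lambda phi c).
Proof.
move=> Sphi c_smooth Jc w cw.
have SL z : Defs.codom c z -> S3xS3 (local phi c z) by move=> _; exact: Sphi.
have f_diff :=
  derivable_sqr_pz (@codom_open _ _ c) cw c_smooth SL Jc.
have kf_diff := derivableZ (k := ((4^-1 : R) +i* (Num.sqrt 3 / 4))%C) f_diff.
apply: (near_eq_derivable _ kf_diff).
have near_c := open_nbhs_nbhs (conj (@codom_open _ _ c) cw).
apply: filterS (near_Re_Im near_c) => z cz.
exact: esym (LambdaE (SL _ cz) (Jc _ cz)).
Qed.

(** With l = s + i t the derivative of the transition map, phi_u and phi_v in
    the coordinate c are s psi_u + t psi_v and - t psi_u + s psi_v, for psi the
    map in the coordinate d; that is, phi_z = l psi_z. *)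
Lemma Lambda_transition phi c d w :
  differentiable (local phi d) (transition c d w) ->
  differentiable (transition c d) w ->
  derivable (of_z (zcoord \o transition c d)) (zcoord w) 1 ->
  overlap c d w ->
  Lambda phi c w =
  Lambda phi d (transition c d w) * d_z (zcoord \o transition c d) w ^+ 2.
Proof.
move=> dL dT T_holo cdw.
have [] := CauchyRiemann (a := fun z => (transition c d z).1)
  (b := fun z => (transition c d z).2) (derivableP T_holo).
rewrite -/(d_z _ w); set l := d_z _ w => -[_ Tu1] [_ Tu2] [_ Tv1] [_ Tv2].
pose L := local phi d; pose T := transition c d.
have dT1 v : ('D_v T w).1 = 'D_v (fun z => (T z).1) w.
  by case: (is_derive_fst (derivableP (diff_derivable (v := v) dT))) => _ ->.
have dT2 v : ('D_v T w).2 = 'D_v (fun z => (T z).2) w.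
  by case: (is_derive_snd (derivableP (diff_derivable (v := v) dT))) => _ ->.
have dLc v : 'D_v (local phi c) w =
    ('D_v T w).1 *: d_u L (T w) + ('D_v T w).2 *: d_v L (T w).
  apply: etrans (derive_comp_uv v dT dL); apply: near_eq_derive.
  by apply: filterS (overlap_nbhs cdw) => z; exact: local_transition.
have dLc_u : d_u (local phi c) w =
    complex.Re l *: d_u L (T w) + complex.Im l *: d_v L (T w).
  by rewrite [LHS]dLc dT1 dT2 Tu1 Tu2.
have dLc_v : d_v (local phi c) w =
    - complex.Im l *: d_u L (T w) + complex.Re l *: d_v L (T w).
  by rewrite [LHS]dLc dT1 dT2 Tv1 Tv2.
rewrite /Lambda /phi_z dLc_u dLc_v (local_transition phi cdw) -/L -/T /=.
move: (d_u L (T w)) (d_v L (T w)) => Z W.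
have -> : (2^-1 *: (complex.Re l *: Z + complex.Im l *: W),
    - (2^-1 *: (- complex.Im l *: Z + complex.Re l *: W))) =
    (complex.Re l *: (2^-1 *: Z) - complex.Im l *: (- (2^-1 *: W)),
     complex.Im l *: (2^-1 *: Z) + complex.Re l *: (- (2^-1 *: W))).
  congr (_, _).
    by rewrite scalerN opprK scalerDr !scalerA ![2^-1 * _]mulrC.
  rewrite scalerN scalerDr opprD !scalerA mulrN scaleNr opprK.
  by rewrite ![2^-1 * _]mulrC.
rewrite nkg_C_scale mulrC; congr (_ * _ ^+ 2).
by case: (l).
Qed.

End QuadraticDifferential.

Theorem lemma3p7 (R : realType) (M : surface R) (X : complex_structure M)
    (phi : M -> ambient R)
    (phi_ac : almost_complex_surface phi)
    (X_isothermal : forall c, complex_coordinate X c ->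
       isothermal phi c /\ J_oriented phi c) :
  holomorphic_quadratic_differential X (Lambda phi).
Proof.
have [Sphi [phi_smooth _] _] := phi_ac; split => [c Xc|c d Xc Xd w cdw].
  apply: Lambda_holomorphic => //; last by have [] := X_isothermal c Xc.
  by apply: phi_smooth; exact: (complex_smooth Xc).
have atlas_c : atlas c by exact: (complex_smooth Xc).
have atlas_d : atlas d by exact: (complex_smooth Xd).
apply: Lambda_transition => //.
- apply: smooth_on_differentiable (phi_smooth d atlas_d) _.
  by case: cdw => cw dw; exact: coord_codom.
- have [T_smooth _] := atlas_compatible atlas_c atlas_d.
  exact: smooth_on_differentiable T_smooth cdw.
- exact: complex_holomorphic Xc Xd _ cdw.
Qed.
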